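(* Let $u_0$ be an admissible initial value and let $M_0=\int_\Omega u_0(\mathbf{x})\,\mathrm{d}\mathbf{x}$. Suppose that $\kappa\ge \max_{|\xi|\le 1}(|f'(\xi)|+|g'(\xi)|)=4$ and $\|u_0\|\le 1$ with $|M_0|\neq|\Omega|$. Then the ETD1 scheme preserves the discrete maximum bound principle unconditionally, i.e., for any time step size $\tau>0$, the ETD1 solution satisfies $\|u^n\|\le 1$ for any $n\ge 0$.
   Context: Let $\Omega\subset\mathbb{R}^d$ ($d=2,3$) be open, connected and bounded with Lipschitz boundary, $\varepsilon>0$, and let $\|\cdot\|$ be the supremum norm on $C(\overline\Omega)$. Boundary conditions: either homogeneous Neumann ($\partial u/\partial\mathbf{n}=0$ on $\partial\Omega$), or periodic, in which case $\Omega=\prod_{i=1}^d(a_i,b_i)$ and all functions, including $u_0$, are periodic. An admissible initial value is $u_0\in C(\overline\Omega)$ (periodic in the periodic case). Put $f(s)=s-s^3$, $g(s)=1-s^2$, and for $\xi\in C(\overline\Omega)$ with $\int_\Omega g(\xi)\,\mathrm{d}\mathbf{x}\ne0$, $$\lambda_\xi=\frac{\int_\Omega f(\xi(\mathbf{x}))\,\mathrm{d}\mathbf{x}}{\int_\Omega g(\xi(\mathbf{x}))\,\mathrm{d}\mathbf{x}},\qquad \mathcal{N}[\xi]=\kappa\xi+f(\xi)-\lambda_\xi\, g(\xi).$$ Let $\mathcal{L}_\kappa=\varepsilon^2\Delta-\kappa\mathcal{I}$, where $\Delta$ is the Laplacian with the chosen boundary condition; $\{e^{t\Delta}\}_{t\ge0}$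 is the contraction semigroup it generates with respect to the supremum norm (on $C(\overline\Omega)$, or its subspace of periodic functions in the periodic case), and $e^{t\mathcal{L}_\kappa}=e^{-\kappa t}e^{t\varepsilon^2\Delta}$. ETD1 scheme with step $\tau>0$: $u^0=u_0$, and for $n\ge 0$, $u^{n+1}=w^n(\tau)$, where $w^n$ solves $\partial_s w^n=\mathcal{L}_\kappa w^n+\mathcal{N}[u^n]$ in $\Omega$ for $s\in(0,\tau]$, $w^n(\cdot,0)=u^n$, with the chosen boundary condition; equivalently $$u^{n+1}=e^{\tau\mathcal{L}_\kappa}u^n+\int_0^\tau e^{(\tau-s)\mathcal{L}_\kappa}\mathcal{N}[u^n]\,\mathrm{d}s.$$ *)

(* Defs.v *)
From HB Require Import structures.
From mathcomp Require Import all_boot all_order all_algebra.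
From mathcomp Require Import all_classical all_reals all_analysis.

Set Implicit Arguments.
Unset Strict Implicit.
Unset Printing Implicit Defensive.

Import Order.TTheory GRing.Theory Num.Theory.
Import numFieldNormedType.Exports.

Local Open Scope classical_set_scope.
Local Open Scope ring_scope.

Section Space.
Variables (R : realType) (d : nat).
Local Notation E := 'rV[R]_d.
Implicit Types (Omega : set E) (u v phi psi : E -> R).

(* R^d with its Borel sigma-algebra; convertible to 'rV[R]_d. *)
Definition borel := g_sigma_algebraType (@open 'rV[R]_d).

(* This determines mu: the boxes are stable under intersection, generate the
   Borel sets, and R^d is a countable union of boxes of finite volume. *)
Definition is_lebesgue (mu : {measure set borel -> \bar R}) :=
  forall a b : E, (forall i, a 0 i <= b 0 i) ->
    mu [set x : borel | forall i, a 0 i <= (x : E) 0 i <= b 0 i] =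
      (\prod_i (b 0 i - a 0 i))%:E.

(* Near each boundary point, after the orthogonal change of coordinates
   y = x *m Q, Omega is the region below the graph of a Lipschitz function
   gamma of the coordinates y_j, j != k. *)
Definition lipschitz_boundary Omega :=
  forall p, (closure Omega `\` Omega°) p ->
    exists (Q : 'M[R]_d) (k : 'I_d) (gamma : 'rV[R]_d.-1 -> R) (L r : R),
      [/\ Q *m Q^T = 1%:M, L.-lipschitz gamma, 0 < r &
          forall x, ball p r x ->
            (Omega x <-> (x *m Q) 0 k < gamma (col' k (x *m Q)))].

Definition lipschitz_domain Omega :=
  [/\ open Omega, connected Omega, bounded_set Omega & lipschitz_boundary Omega].

Inductive bcond := Neumann | Periodic of E & E.

Definition bcond_ok (bc : bcond) Omega :=
  match bc with
  | Neumann => True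
  | Periodic a b => (forall i, a 0 i < b 0 i) /\
      Omega = [set x | forall i, a 0 i < x 0 i < b 0 i]
  end.

(* The space C(closure Omega), resp. its subspace of periodic functions.  Its
   elements are represented by functions on all of R^d whose values outside
   closure Omega are irrelevant. *)
Definition state (bc : bcond) Omega u :=
  {within closure Omega, continuous u} /\
  match bc with
  | Neumann => True
  | Periodic a b => forall i x, closure Omega x -> x 0 i = a 0 i ->
      u (x + (b 0 i - a 0 i) *: delta_mx 0 i) = u x
  end.

(* A genuine supremum on elements of state bc Omega, for which the set is
   bounded because closure Omega is compact. *)
Definition supnorm Omega u : R := sup [set `|u x| | x in closure Omega].

Definition partial (i : 'I_d) u : E -> R :=
  fun x => 'D_(delta_mx 0 i) (u : E -> R^o) x.

Definition smooth phi :=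
  forall s : seq 'I_d, let psi := foldr partial phi s in
    continuous psi /\
    forall i x, derivable (psi : E -> R^o) x (delta_mx 0 i).

Definition test_function Omega psi :=
  smooth psi /\
  exists K : set E, [/\ compact K, K `<=` Omega & forall x, ~ K x -> psi x = 0].

(* Smooth functions on closure Omega (restrictions from R^d), periodic in the
   periodic case; dense in H^1(Omega), resp. in periodic H^1, since Omega is a
   Lipschitz domain. *)
Definition bc_test (bc : bcond) phi :=
  smooth phi /\
  match bc with
  | Neumann => True
  | Periodic a b => forall i x,
      phi (x + (b 0 i - a 0 i) *: delta_mx 0 i) = phi x
  end.

Variable mu : {measure set borel -> \bar R}.

(* G is the square-integrable distributional gradient of u in Omega. *)
Definition weak_gradient Omega u (G : 'I_d -> E -> R) :=
  forall i,
    [/\ measurable_fun (Omega : set borel) (G i : borel -> R),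
        mu.-integrable (Omega : set borel) (fun x => ((G i x) ^+ 2)%:E) &
        forall psi, test_function Omega psi ->
          \int[mu]_(x in Omega) (u x * partial i psi x) =
          - \int[mu]_(x in Omega) (G i x * psi x)].

(* v = Delta u with the boundary condition bc, in variational form: u is in
   H^1(Omega) and  int grad u . grad phi = - int v phi  for all phi.  In the
   Neumann case the arbitrary boundary values of phi encode the condition
   du/dn = 0, which has no pointwise meaning on a Lipschitz boundary.  In the
   periodic case this says that Delta u = v on the torus. *)
Definition is_laplacian (bc : bcond) Omega u v :=
  [/\ state bc Omega u, state bc Omega v &
      exists2 G, weak_gradient Omega u G &
        forall phi, bc_test bc phi ->
          \int[mu]_(x in Omega) (\sum_i G i x * partial i phi x) =
          - \int[mu]_(x in Omega) (v x * phi x)].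

(* S t = e^{t Delta}: S is a strongly continuous contraction semigroup on
   state bc Omega, with the supremum norm, whose infinitesimal generator is
   exactly Delta with the boundary condition bc (so S is unique). *)
Record heat_semigroup (bc : bcond) Omega (S : R -> (E -> R) -> (E -> R)) : Prop :=
  HeatSemigroup {
    heat_state : forall t u, 0 <= t -> state bc Omega u ->
      state bc Omega (S t u);
    heat_linear : forall t (c : R) u v, 0 <= t ->
      state bc Omega u -> state bc Omega v ->
      {in closure Omega,
        S t (fun x => c * u x + v x) =1 (fun x => c * S t u x + S t v x)};
    heat0 : forall u, state bc Omega u -> {in closure Omega, S 0 u =1 u};
    heatD : forall s t u, 0 <= s -> 0 <= t -> state bc Omega u ->
      {in closure Omega, S (s + t) u =1 S s (S t u)};
    heat_contraction : forall t u, 0 <= t -> state bc Omega u ->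
      supnorm Omega (S t u) <= supnorm Omega u;
    heat_cvg0 : forall u, state bc Omega u ->
      supnorm Omega (fun x => S t u x - u x) @[t --> 0^'+] --> 0;
    heat_generator : forall u v, state bc Omega u -> state bc Omega v ->
      (supnorm Omega (fun x => t^-1 * (S t u x - u x) - v x) @[t --> 0^'+] --> 0
       <-> is_laplacian bc Omega u v)
  }.

End Space.

Section Scheme.
Variables (R : realType) (d : nat) (mu : {measure set borel R d -> \bar R}).
Local Notation E := 'rV[R]_d.
Variables (Omega : set E) (S : R -> (E -> R) -> (E -> R)).
Variables (eps kappa tau : R).

Definition f (s : R) : R := s - s ^+ 3.
Definition g (s : R) : R := 1 - s ^+ 2.

(* Junk value 0 when the denominator vanishes. *)
Definition lambda (xi : E -> R) : R :=
  (\int[mu]_(x in Omega) f (xi x)) / (\int[mu]_(x in Omega) g (xi x)).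

Definition nonlin (xi : E -> R) : E -> R :=
  fun x => kappa * xi x + f (xi x) - lambda xi * g (xi x).

(* e^{t L_kappa}, with L_kappa = eps^2 Delta - kappa I and S t = e^{t Delta}. *)
Definition expL (t : R) (u : E -> R) : E -> R :=
  fun x => expR (- kappa * t) * S (eps ^+ 2 * t) u x.

(* The integral of the continuous curve s |-> e^{(tau - s) L_kappa} N[u] with
   values in C(closure Omega) is computed pointwise, evaluation at x being a
   continuous linear form. *)
Definition etd1_step (u : E -> R) : E -> R :=
  fun x => expL tau u x +
    \int[lebesgue_measure]_(s in `[0, tau]) expL (tau - s) (nonlin u) x.

Definition etd1 (u0 : E -> R) (n : nat) : E -> R := iter n etd1_step u0.

End Scheme.

Definition is_maximum (R : realType) (A : set R) (m : R) := A m /\ ubound A m.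

Definition stab_set (R : realType) : set R :=
  [set `|derive1 (@f R) xi| + `|derive1 (@g R) xi| | xi in [set xi | `|xi| <= 1]].
Arguments stab_set R : clear implicits.

(* Main.v *)
Require Import Defs.
From HB Require Import structures.
From mathcomp Require Import all_boot all_order all_algebra.
From mathcomp Require Import all_classical all_reals all_analysis.
From mathcomp Require Import ring lra.

Set Implicit Arguments.
Unset Strict Implicit.
Unset Printing Implicit Defensive.

Import Order.TTheory GRing.Theory Num.Theory.
Import numFieldNormedType.Exports.

Local Open Scope classical_set_scope.
Local Open Scope ring_scope.

(** Write F(xi) = kappa xi + f(xi) - la g(xi).  Since f(xi) = xi g(xi), one has

        kappa - F(xi) = (1 - xi) (kappa - (xi - la) (1 + xi)),
        kappa + F(xi) = (1 + xi) (kappa + (xi - la) (1 - xi)),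

    and both second factors are nonnegative when |xi| <= 1, |la| <= 1 and
    4 <= kappa.  Hence |u^n| <= 1 gives |N[u^n]| <= kappa, provided that the
    multiplier lambda is well defined and at most 1 in absolute value; the
    latter follows from |f| <= g on [-1, 1].  As e^{t Delta} contracts the
    supremum norm, the variation of constants formula yields
    |u^{n+1}| <= e^{- kappa tau} + int_0^tau kappa e^{- kappa (tau - s)} ds = 1.

    What has to be propagated besides the bound is int g(u^n) > 0, that is, the
    existence of a point x0 of Omega with |u^n(x0)| < 1.  This is done without
    conservation of mass, at that same point x0: the bound on F is strict for
    |xi| < 1, so |N[u^n](x0)| < kappa.  This is the value at s = tau of the
    integrand of the variation of constants formula, which is continuous in s;
    so the integrand is strictly below its bound for s near tau, and
    |u^{n+1}(x0)| < 1.

    For n = 0 the point x0 comes from the connectedness of Omega: if |u_0| = 1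
    on all of Omega, then u_0 is constant there, and |M_0| = |Omega|.

    It remains to see that u^{n+1} is continuous on the closure of Omega.  A
    strongly continuous semigroup has uniformly continuous orbits, so by
    compactness of the time interval the functions e^{t Delta} v, 0 <= t <= T,
    are equicontinuous, and their time integral is continuous. *)

(** * The pointwise nonlinearity *)

Lemma is_derive_f (R : realType) (x : R) : is_derive x 1 (@f R) (1 - 3 * x ^+ 2).
Proof.
apply: (@is_derive_eq _ _ _ (fun s : R => s - s ^+ 3)).
by rewrite /GRing.scale /=; ring.
Qed.

Lemma is_derive_g (R : realType) (x : R) : is_derive x 1 (@g R) (- (2 * x)).
Proof.
apply: (@is_derive_eq _ _ _ (fun s : R => 1 - s ^+ 2)).
by rewrite /GRing.scale /=; ring.
Qed.

Lemma stab_set_maximum (R : realType) : is_maximum (stab_set R) 4.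
Proof.
have E x : `|derive1 (@f R) x| + `|derive1 (@g R) x| =
    `|1 - 3 * x ^+ 2| + 2 * `|x|.
  rewrite !derive1E (@derive_val _ _ _ _ _ _ _ (is_derive_f x)).
  by rewrite (@derive_val _ _ _ _ _ _ _ (is_derive_g x)) normrN normrM ger0_norm.
split; first by exists 1 => [/=|]; rewrite ?E normr1// expr1n ler0_norm; lra.
move=> _ [x /= x1 <-]; rewrite E -real_normK ?num_real//.
have := normr_ge0 x; move: `|x| x1 => y y1 y0.
by case: (ger0P (1 - 3 * y ^+ 2)) => h; nra.
Qed.

Lemma g_ge0 (R : realType) (xi : R) : `|xi| <= 1 -> 0 <= g xi.
Proof. by rewrite ler_norml /g => /andP[a b]; nra. Qed.

Lemma normr_f_le (R : realType) (xi : R) : `|xi| <= 1 -> `|f xi| <= g xi.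
Proof.
move=> h; have -> : f xi = xi * g xi by rewrite /f /g; ring.
by rewrite normrM (ger0_norm (g_ge0 h)) ler_piMl// g_ge0.
Qed.

(** With F = kappa xi + f xi - la g xi, one has kappa - F = (1 - xi) (kappa - A)
    and kappa + F = (1 + xi) (kappa - B), where A = (xi - la) (1 + xi) and
    B = (la - xi) (1 - xi) are products of two factors at most 2. *)
Lemma nonlinearity_le (R : realType) (kappa la xi : R) :
  4 <= kappa -> `|la| <= 1 -> `|xi| <= 1 ->
  `|kappa * xi + f xi - la * g xi| <= kappa.
Proof.
rewrite !ler_norml /f /g => k /andP[l1 l2] /andP[x1 x2].
have A : (xi - la) * (1 + xi) <= 4 by nra.
have B : (la - xi) * (1 - xi) <= 4 by nra.
by apply/andP; split; nra.
Qed.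

(** The same factorization: 1 - xi and 1 + xi are now positive, and they are
    smaller than 2, so that A and B are smaller than 4. *)
Lemma nonlinearity_lt (R : realType) (kappa la xi : R) :
  4 <= kappa -> `|la| <= 1 -> `|xi| < 1 ->
  `|kappa * xi + f xi - la * g xi| < kappa.
Proof.
rewrite ler_norml !ltr_norml /f /g => k /andP[l1 l2] /andP[x1 x2].
have A : (xi - la) * (1 + xi) < 4 by nra.
have B : (la - xi) * (1 - xi) < 4 by nra.
by apply/andP; split; nra.
Qed.

(** * Positivity of integrals *)

Section PositiveIntegral.
Local Open Scope ereal_scope.

Lemma Rintegral_gt0 d (T : measurableType d) (R : realType)
    (mu : {measure set T -> \bar R}) (D B : set T) (h : T -> R) (c : R) :
  measurable D -> measurable B -> B `<=` D -> 0 < mu B ->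
  mu.-integrable D (EFin \o h) -> (forall x, D x -> (0 <= h x)%R) ->
  (0 < c)%R -> (forall x, B x -> (c <= h x)%R) ->
  (0 < \int[mu]_(x in D) h x)%R.
Proof.
move=> mD mB BD B0 ih h0 c0 hB.
have mh := measurable_int _ ih.
rewrite fine_gt0// [X in _ && X]ltey_eq integrable_fin_num// andbT.
apply: (@lt_le_trans _ _ (\int[mu]_(x in B) c%:E)).
  by rewrite integral_cst// mule_gt0.
apply: (@le_trans _ _ (\int[mu]_(x in B) (h x)%:E)).
  apply: ge0_le_integral => //.
  - by move=> x _; rewrite lee_fin ltW.
  - exact: measurable_funS mh.
by apply: ge0_subset_integral => // x xD; rewrite lee_fin h0.
Qed.

End PositiveIntegral.

(** * Variation of constants in time *)

Section Duhamel.
Variables (R : realType) (kappa tau : R).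
Hypotheses (kappa0 : 0 < kappa) (tau0 : 0 < tau).
Local Notation leb := (@lebesgue_measure R).

Lemma continuous_expR_kernel : continuous (fun s : R => expR (- kappa * (tau - s))).
Proof.
move=> s; apply: continuous_comp; last exact: continuous_expR.
apply: cvgMr; apply: cvgB => //; exact: cvg_cst.
Qed.

Lemma Rintegral_expR_kernel :
  \int[leb]_(s in `[0, tau]) (kappa * expR (- kappa * (tau - s))) =
  1 - expR (- kappa * tau).
Proof.
have dF (x : R) : is_derive x 1 (fun s : R => expR (- kappa * (tau - s)))
    (kappa * expR (- kappa * (tau - x))).
  apply: is_derive_eq; rewrite /GRing.scale /=; ring.
have cF := continuous_expR_kernel.
rewrite /Rintegral (@continuous_FTC2 _ _ (fun s => expR (- kappa * (tau - s))))//=.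
- by rewrite subrr mulr0 expR0 subr0.
- apply: continuous_subspaceT => s; apply: cvgMr; exact: cF.
- split.
  + by move=> x _; case: (dF x).
  + exact: cvg_at_right_filter (cF _).
  + exact: cvg_at_left_filter (cF _).
- by move=> x _; rewrite derive1E derive_val.
Qed.

Lemma segment_integrable (h : R -> R) :
  {within `[0, tau], continuous h} -> leb.-integrable `[0, tau] (EFin \o h).
Proof.
by move=> ch; apply: continuous_compact_integrable => //; exact: segment_compact.
Qed.

Lemma Duhamel_le (h : R -> R) :
  {within `[0, tau], continuous h} ->
  (forall s, 0 <= s <= tau -> `|h s| <= kappa * expR (- kappa * (tau - s))) ->
  `|\int[leb]_(s in `[0, tau]) h s| <= 1 - expR (- kappa * tau).
Proof.
move=> ch hle; rewrite -Rintegral_expR_kernel.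
have ih := segment_integrable ch.
apply: (le_trans (le_normr_Rintegral _ ih)) => //.
apply: le_Rintegral => //.
- exact: integrable_norm.
- apply: segment_integrable.
  apply: continuous_subspaceT => s; apply: cvgMr; exact: continuous_expR_kernel.
Qed.

(** The integrand is strictly below its bound at the end point s = tau, hence,
    by continuity, on an interval of positive length ending there. *)
Lemma Duhamel_lt (h : R -> R) :
  {within `[0, tau], continuous h} ->
  (forall s, 0 <= s <= tau -> `|h s| <= kappa * expR (- kappa * (tau - s))) ->
  `|h tau| < kappa ->
  `|\int[leb]_(s in `[0, tau]) h s| < 1 - expR (- kappa * tau).
Proof.
move=> ch hle hlt; rewrite -Rintegral_expR_kernel.
pose k s := kappa * expR (- kappa * (tau - s)).
have ck : {within `[0, tau], continuous k}.
  apply: continuous_subspaceT => s; apply: cvgMr; exact: continuous_expR_kernel.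
have ih := segment_integrable ch.
have ik := segment_integrable ck.
have inh : leb.-integrable `[0, tau] (EFin \o (fun s => `|h s|)).
  exact: integrable_norm.
apply: (le_lt_trans (le_normr_Rintegral _ ih)) => //.
rewrite -subr_gt0 -RintegralB//.
(* Half of the gap at s = tau: the gap stays above c on some ]b, tau[. *)
pose c := (kappa - `|h tau|) / 2.
have c0 : 0 < c by rewrite /c; lra.
have cl : (k s - `|h s|) @[s --> tau^'-] --> kappa - `|h tau|.
  have /(continuous_within_itvP _ tau0)[_ _ cht] := ch.
  have /(continuous_within_itvP _ tau0)[_ _ ckt] := ck.
  have -> : kappa = k tau by rewrite /k subrr mulr0 expR0 mulr1.
  by apply: cvgB => //; exact: cvg_norm.
have [b [b0 bt hb]] : exists b, [/\ 0 <= b, b < tau &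
    forall s, b < s < tau -> c <= k s - `|h s|].
  have /cvgrPdist_lt/(_ c c0)[e /= e0 he] := cl.
  exists (Num.max 0 (tau - e)); split; first by rewrite le_max lexx.
  - by rewrite gt_max tau0 /=; lra.
  - move=> s; rewrite gt_max -andbA => /and3P[s0 se st].
    have := he s; rewrite /= /ball_ => /(_ _ st).
    rewrite ger0_norm; last by lra.
    have se' : tau - s < e by lra.
    move=> /(_ se') /ltW; rewrite ler_distlC /c => /andP[+ _]; lra.
apply: (@Rintegral_gt0 _ _ _ leb _ `]b, tau[%classic _ c) => //.
- move=> s /=; rewrite !in_itv /= => /andP[bs st]; apply/andP; split; lra.
- suff : (0 < leb `]b, tau[%classic)%E by [].
  by rewrite lebesgue_measure_itv /= lte_fin bt -EFinB lte_fin subr_gt0.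
- exact: (integrableB _ ik inh).
- by move=> s /=; rewrite in_itv /= subr_ge0; exact: hle.
Qed.

End Duhamel.

(** * The supremum norm and the spaces of states *)

Section SupNorm.
Variables (R : realType) (d : nat) (Omega : set 'rV[R]_d).
Implicit Types u v : 'rV[R]_d -> R.

Lemma bounded_closure_compact : bounded_set Omega -> compact (closure Omega).
Proof.
move=> bO; apply: bounded_closed_compact; last exact: closed_closure.
case: bO => M0 [rM hM0]; exists M0; split => // M /hM0 hM x.
rewrite closureE; apply; split => //.
rewrite (_ : [set _ | _] = (fun y : 'rV[R]_d => `|y|) @^-1` [set y | y <= M])//.
apply: closed_comp; last exact: closed_le.
move=> y _; exact: norm_continuous.
Qed.

Hypothesis cO : compact (closure Omega).

Lemma normr_le_supnorm u x : {within closure Omega, continuous u} ->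
  closure Omega x -> `|u x| <= supnorm Omega u.
Proof.
move=> cu Ox; apply: ub_le_sup; last by exists x.
have /compact_bounded[M [_ hM]] := continuous_compact cu cO.
exists (M + 1) => _ [y Oy <-]; apply: hM; first by rewrite ltrDl.
by exists y.
Qed.

(** The bound c has to be nonnegative because the closure may be empty, in which
    case the supremum norm is 0. *)
Lemma supnorm_le u c : 0 <= c -> (forall x, closure Omega x -> `|u x| <= c) ->
  supnorm Omega u <= c.
Proof.
move=> c0 uc; have [e0 | /set0P[x Ox]] := eqVneq (closure Omega) set0.
  by rewrite /supnorm e0 image_set0 sup0.
by apply: ge_sup => [|_ [y Oy <-]]; [exists `|u x|; exists x|exact: uc].
Qed.

Lemma state_linear bc c u v : state bc Omega u -> state bc Omega v ->
  state bc Omega (fun x => c * u x + v x).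
Proof.
move=> [cu pu] [cv pv]; split.
  by move=> x; apply: cvgD; [apply: cvgMr; exact: cu|exact: cv].
case: bc pu pv => // a b pu pv i x Ox xa.
by rewrite pu// pv.
Qed.

Lemma state_comp bc (h : R -> R) u : continuous h -> state bc Omega u ->
  state bc Omega (h \o u).
Proof.
move=> ch [cu pu]; split.
  move=> x; apply: (@continuous_comp (subspace (closure Omega)) _ _ u h).
    exact: cu.
  exact: ch.
case: bc pu => // a b pu i x Ox xa /=.
by rewrite pu.
Qed.

End SupNorm.

(** * Regularity of semigroup orbits *)

Section Semigroup.
Variables (R : realType) (d : nat) (mu : {measure set (borel R d) -> \bar R}).
Variables (Omega : set 'rV[R]_d) (bc : bcond R d).
Variable S : R -> ('rV[R]_d -> R) -> ('rV[R]_d -> R).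
Hypotheses (hS : heat_semigroup mu bc Omega S) (cO : compact (closure Omega)).

Lemma heat_normr_le t u c : 0 <= t -> state bc Omega u -> 0 <= c ->
  (forall x, closure Omega x -> `|u x| <= c) ->
  forall x, closure Omega x -> `|S t u x| <= c.
Proof.
move=> t0 su c0 uc x Ox.
apply: (le_trans (normr_le_supnorm cO (heat_state hS t0 su).1 Ox)).
exact: (le_trans (heat_contraction hS t0 su) (supnorm_le c0 uc)).
Qed.

(** S (s + h) u - S s u = S s (S h u - u), and S s is a contraction: the size of
    an increment of an orbit is controlled by its length h alone. *)
Lemma heat_increment_le s h u : 0 <= s -> 0 <= h -> state bc Omega u ->
  forall x, closure Omega x ->
  `|S (s + h) u x - S s u x| <= supnorm Omega (fun x => S h u x - u x).
Proof.
move=> s0 h0 su x Ox.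
have Ox' : x \in closure Omega by rewrite inE.
have sh := heat_state hS h0 su.
have sd : state bc Omega (fun x => -1 * u x + S h u x) by exact: state_linear.
have -> : S (s + h) u x - S s u x = S s (fun x => -1 * u x + S h u x) x.
  by rewrite (heatD hS)// (heat_linear hS)// mulN1r addrC.
apply: (le_trans (normr_le_supnorm cO (heat_state hS s0 sd).1 Ox)).
apply: (le_trans (heat_contraction hS s0 sd)).
by under eq_fun do rewrite mulN1r addrC.
Qed.

Lemma heat_unif_continuous u e : state bc Omega u -> 0 < e ->
  exists2 del, 0 < del & forall s t, 0 <= s -> 0 <= t -> `|t - s| < del ->
  forall x, closure Omega x -> `|S t u x - S s u x| <= e.
Proof.
move=> su e0.
have /cvgrPdist_le/(_ e e0)[del /= del0 hdel] := heat_cvg0 hS su.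
have H s t : 0 <= s -> s <= t -> `|t - s| < del ->
  forall x, closure Omega x -> `|S t u x - S s u x| <= e.
  move=> s0; rewrite le_eqVlt => /predU1P[-> _ x _|st ts x Ox].
    by rewrite subrr normr0 ltW.
  have h0 : 0 < t - s by rewrite subr_gt0.
  rewrite -{1}(subrK s t) (addrC _ s).
  apply: (le_trans (heat_increment_le s0 (ltW h0) su Ox)).
  have := hdel (t - s); rewrite /= sub0r normrN => /(_ ts h0).
  by rewrite sub0r normrN => /(le_trans (ler_norm _)).
exists del => // s t s0 t0 st x Ox; have [ts|/ltW ts] := leP s t.
  exact: H.
by rewrite distrC H// distrC.
Qed.

(** Uniform continuity in t reduces the claim near a given time to the continuity
    of a single function S t u; compactness of the time interval then makes the
    neighbourhood of x independent of the time. *)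
Lemma heat_equicontinuous u T e x : state bc Omega u -> 0 < e ->
  closure Omega x ->
  \forall y \near within (closure Omega) (nbhs x),
    forall t, 0 <= t <= T -> `|S t u x - S t u y| <= e.
Proof.
move=> su e0 Ox.
have e3 : 0 < e / 3 by rewrite divr_gt0.
have [del del0 hdel] := heat_unif_continuous su e3.
have /compact_near_coveringP/near_covering_withinP := @segment_compact R 0 T.
move=> /(_ _ (within (closure Omega) (nbhs x))
         (fun y t => `|S t u x - S t u y| <= e)) cov.
have {}cov : \forall y \near within (closure Omega) (nbhs x),
    `[0, T]%classic `<=` (fun t => `|S t u x - S t u y| <= e).
  apply: cov => t /=; rewrite in_itv /= => /andP[t0 tT].
  have /subspace_continuousP/(_ x Ox)/cvgrPdist_le/(_ _ e3) cx :=
    (heat_state hS t0 su).1.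
  exists ([set t' | `|t' - t| < del],
    [set y | closure Omega y /\ `|S t u x - S t u y| <= e / 3]).
    split => /=.
      by exists del => // t'; rewrite /= distrC.
    by apply: filterI; [exact: withinT|exact: cx].
  move=> [t' y] /= [tt' [yO hy]]; rewrite in_itv /= => /andP[t'0 _].
  have h1 := hdel _ _ t0 t'0 tt' _ Ox.
  have h2 := hdel _ _ t0 t'0 tt' _ yO.
  have -> : S t' u x - S t' u y = (S t' u x - S t u x) + (S t u x - S t u y)
    - (S t' u y - S t u y) by ring.
  apply: (le_trans (ler_normB _ _)).
  have := ler_normD (S t' u x - S t u x) (S t u x - S t u y).
  lra.
apply: filterS cov => y h t tT; apply: h.
by rewrite /= in_itv.
Qed.

Variables (eps kappa tau : R).
Hypotheses (kappa0 : 0 < kappa) (tau0 : 0 < tau).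
Local Notation leb := (@lebesgue_measure R).
Local Notation curve v x := (fun s => expL S eps kappa (tau - s) v x).

Lemma expL_continuous v x : state bc Omega v -> closure Omega x ->
  {within `[0, tau], continuous (curve v x)}.
Proof.
move=> sv Ox; apply/subspace_continuousP => s; rewrite /= in_itv /= => /andP[s0 st].
apply: cvgM.
  apply: cvg_within_filter.
  exact: continuous_expR_kernel.
apply/cvgrPdist_le => e e0.
have [del del0 hdel] := heat_unif_continuous sv e0.
(* Time runs at speed eps ^+ 2; adding 1 avoids a case distinction on eps. *)
have e1 : 0 < eps ^+ 2 + 1 by rewrite ltr_wpDl// sqr_ge0.
exists (del / (eps ^+ 2 + 1)) => /=; first by rewrite divr_gt0.
move=> s' /=; rewrite ltr_pdivlMr// => ss'; rewrite in_itv /= => /andP[s'0 s't].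
apply: hdel => //.
- by rewrite mulr_ge0 ?sqr_ge0// subr_ge0.
- by rewrite mulr_ge0 ?sqr_ge0// subr_ge0.
- apply: le_lt_trans ss'.
  rewrite -mulrBr normrM (ger0_norm (sqr_ge0 _)) mulrC.
  rewrite (_ : tau - s - (tau - s') = - (s - s')); last by ring.
  by rewrite normrN ler_wpM2l// lerDl.
Qed.

Lemma expL_state t v : 0 <= t -> state bc Omega v ->
  state bc Omega (expL S eps kappa t v).
Proof.
move=> t0 sv; have := heat_state hS (mulr_ge0 (sqr_ge0 eps) t0) sv.
by apply: (@state_comp _ _ _ _ (fun y => _ * y)) => y; exact: cvgMr.
Qed.

(** The kernel e^{- kappa (tau - s)} is at most 1, so equicontinuity with modulus
    e / tau makes the integrals differ by at most e. *)
Lemma Duhamel_state v : state bc Omega v ->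
  state bc Omega (fun x => \int[leb]_(s in `[0, tau]) curve v x s).
Proof.
move=> sv; split; last first.
  have per s : s \in `[0, tau]%classic -> state bc Omega (expL S eps kappa (tau - s) v).
    rewrite inE /= in_itv /= => /andP[_ st].
    by apply: expL_state => //; rewrite subr_ge0.
  case: bc per => // a b per i x Ox xa.
  by apply: eq_Rintegral => s /per[_]; apply.
apply/subspace_continuousP => x Ox; apply/cvgrPdist_le => e e0.
have et : 0 < e / tau by rewrite divr_gt0.
have := heat_equicontinuous (eps ^+ 2 * tau) sv et Ox.
have OO : \forall y \near within (closure Omega) (nbhs x), closure Omega y.
  exact: withinT.
apply: filterS2 OO => y Oy hy.
have ix := segment_integrable (expL_continuous sv Ox).
have iy := segment_integrable (expL_continuous sv Oy).
have ib : leb.-integrable `[0, tau]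
    (EFin \o (fun s => curve v x s - curve v y s)).
  exact: (integrableB _ ix iy).
rewrite -RintegralB//.
apply: (le_trans (le_normr_Rintegral _ ib)) => //.
apply: (@le_trans _ _ (\int[leb]_(s in `[0, tau]) (e / tau))).
  apply: le_Rintegral => //.
  - exact: (integrable_norm ib).
  - by apply: segment_integrable; apply: continuous_subspaceT => s; exact: cvg_cst.
  - move=> s; rewrite /= in_itv /= => /andP[s0 st].
    rewrite /expL -mulrBr normrM ger0_norm ?expR_ge0//.
    rewrite -[leRHS]mul1r ler_pM//.
      by rewrite -expR0 ler_expR mulNr oppr_le0 mulr_ge0 ?subr_ge0// ltW.
    apply: hy; rewrite mulr_ge0 ?sqr_ge0 ?subr_ge0//=.
    by rewrite ler_wpM2l ?sqr_ge0// gerBl.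
rewrite Rintegral_cst//= lebesgue_measure_itv /= lte_fin tau0 -EFinB /= subr0.
by rewrite divfK// gt_eqF.
Qed.

Lemma expL_normr_le t v c x : 0 <= t -> state bc Omega v -> 0 <= c ->
  (forall x, closure Omega x -> `|v x| <= c) -> closure Omega x ->
  `|expL S eps kappa t v x| <= c * expR (- kappa * t).
Proof.
move=> t0 sv c0 vc Ox; rewrite /expL normrM ger0_norm ?expR_ge0// mulrC.
rewrite ler_wpM2r ?expR_ge0//.
by apply: heat_normr_le Ox => //; rewrite mulr_ge0// sqr_ge0.
Qed.

End Semigroup.

(** * Lebesgue measure on bounded open sets *)

Section LebesgueBoxes.
Variables (R : realType) (d : nat) (mu : {measure set (borel R d) -> \bar R}).
Hypothesis hmu : is_lebesgue mu.
Implicit Types (Omega : set 'rV[R]_d) (u : 'rV[R]_d -> R).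

(** The closed ball of the supremum norm, written as a box, the sets on which the
    values of mu are prescribed. *)
Definition cube (p : 'rV[R]_d) (r : R) : set (borel R d) :=
  [set x : borel R d | forall i,
    (p - const_mx r) 0 i <= (x : 'rV[R]_d) 0 i <= (p + const_mx r) 0 i].

Lemma mu_cube p r : 0 <= r -> mu (cube p r) = ((2 * r) ^+ d)%:E.
Proof.
move=> r0; rewrite /cube hmu => [|i]; last by rewrite !mxE; lra.
rewrite (eq_bigr (fun=> 2 * r)) => [|i _]; last by rewrite !mxE; ring.
by rewrite prodr_const card_ord.
Qed.

Lemma open_measurable_borel Omega : open Omega -> measurable (Omega : set (borel R d)).
Proof. by move=> oO; exact: sub_sigma_algebra. Qed.

Lemma measurable_cube p r : measurable (cube p r).
Proof.
rewrite -[cube p r]setCK; apply: measurableC; apply: open_measurable_borel.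
rewrite openC.
rewrite (_ : cube p r = \bigcap_(i in [set: 'I_d])
    ((fun x : 'rV[R]_d => x 0 i) @^-1` `[(p - const_mx r) 0 i, (p + const_mx r) 0 i])).
  apply: closed_bigI => i _; apply: closed_comp.
    by move=> x _; exact: coord_continuous.
  exact: interval_closed.
apply/seteqP; split => x hx i.
  by move=> _; have := hx i; rewrite /= in_itv.
by have := hx i I; rewrite /= in_itv.
Qed.

Lemma cube_sub_ball p r : 0 < r -> cube p (r / 2) `<=` ball p r.
Proof.
move=> r0 x hx; split=> // i j; rewrite (ord1 i) /ball /= ltr_norml.
have := hx j; rewrite !mxE => /andP[h1 h2].
apply/andP; split; lra.
Qed.

Lemma lebesgue_bounded_fin Omega : open Omega -> bounded_set Omega ->
  (mu (Omega : set (borel R d)) < +oo)%E.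
Proof.
move=> oO [M0 [rM hM0]].
pose M := Num.max 0 M0 + 1.
have M0M : M0 < M by rewrite ltr_pwDr// le_max lexx orbT.
have Mgt0 : 0 < M by rewrite ltr_wpDl// le_max lexx.
have sub : Omega `<=` cube 0 (M + 1).
  move=> x /(hM0 _ M0M) /= xM i.
  have : ball (0 : 'rV[R]_d) (M + 1) x.
    by rewrite mx_norm_ball /ball_ /= sub0r normrN (le_lt_trans xM)// ltrDl.
  move=> [_ /(_ 0 i)]; rewrite /ball /= !mxE !add0r normrN ltr_norml.
  by move=> /andP[h1 h2]; rewrite !ltW.
apply: (@le_lt_trans _ _ (mu (cube 0 (M + 1)))).
  by apply: le_measure => //; rewrite inE;
    [exact: open_measurable_borel|exact: measurable_cube].
by rewrite mu_cube ?ltry// addr_ge0// ltW.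
Qed.

Lemma state_integrable Omega u : open Omega -> bounded_set Omega ->
  {within closure Omega, continuous u} ->
  mu.-integrable (Omega : set (borel R d)) (EFin \o u).
Proof.
move=> oO bO cu; apply: measurable_bounded_integrable.
- exact: open_measurable_borel.
- exact: lebesgue_bounded_fin.
- apply: (measurability _ (measurable_realfun.RGenOpens.measurableE R)).
  move=> _ [_ [a [b ->] <-]]; apply: open_measurable_borel.
  apply: (iffLR (continuous_inP _ oO)); last exact: interval_open.
  rewrite -continuous_open_subspace//.
  exact: continuous_subspaceW (@subset_closure _ _) cu.
- exists (supnorm Omega u); split; first exact: num_real.
  move=> M hM x Ox /=; apply: (le_trans _ (ltW hM)).
  apply: normr_le_supnorm (subset_closure Ox) => //.
  exact: bounded_closure_compact.
Qed.

Lemma Rintegral_open_gt0 Omega u x0 : open Omega -> bounded_set Omega ->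
  {within closure Omega, continuous u} -> (forall x, Omega x -> 0 <= u x) ->
  Omega x0 -> 0 < u x0 -> 0 < \int[mu]_(x in Omega) u x.
Proof.
move=> oO bO cu u0 Ox0 ux0.
have : nbhs x0 (Omega `&` [set y | u x0 / 2 < u y]).
  apply: open_nbhs_nbhs; split; last by split => //=; lra.
  apply: (iffLR (continuous_inP _ oO) _ [set y | u x0 / 2 < y]); last exact: open_gt.
  rewrite -continuous_open_subspace//.
  exact: continuous_subspaceW (@subset_closure _ _) cu.
move=> /nbhs_ballP[r /= r0 hr].
have r2 : 0 < r / 2 by rewrite divr_gt0.
have cr := subset_trans (cube_sub_ball r0) hr.
apply: (@Rintegral_gt0 _ _ _ mu _ (cube x0 (r / 2)) _ (u x0 / 2)) => //.
- exact: open_measurable_borel.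
- exact: measurable_cube.
- by move=> x /cr[].
- by rewrite mu_cube ?lte_fin ?exprn_gt0 ?mulr_gt0// ltW.
- exact: state_integrable.
- by rewrite divr_gt0.
- by move=> x /cr[_ /ltW].
Qed.

End LebesgueBoxes.

(** * The discrete maximum bound principle *)

Section MaximumBound.
Variables (R : realType) (d : nat) (mu : {measure set (borel R d) -> \bar R}).
Variables (Omega : set 'rV[R]_d) (bc : bcond R d).
Variable S : R -> ('rV[R]_d -> R) -> ('rV[R]_d -> R).
Variables eps kappa tau : R.
Hypotheses (hmu : is_lebesgue mu) (oO : open Omega) (bO : bounded_set Omega).
Hypothesis hS : heat_semigroup mu bc Omega S.
Hypotheses (hkappa : 4 <= kappa) (tau0 : 0 < tau).
Implicit Types u : 'rV[R]_d -> R.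

(** The invariant of the scheme.  The last clause is equivalent, given the first
    two, to int g(u) > 0; as a condition at one point it passes from one step to
    the next without any information on the mass of u. *)
Definition nontrivially_bounded u :=
  [/\ state bc Omega u, forall x, closure Omega x -> `|u x| <= 1 &
      exists2 x, Omega x & `|u x| < 1].

Let cO : compact (closure Omega) := bounded_closure_compact bO.
Let OcO x : Omega x -> closure Omega x := @subset_closure _ _ x.

Lemma continuous_f : continuous (@f R).
Proof.
move=> s; apply: (@cvgB _ _ _ _ _ id (fun y : R => y ^+ 3)); first exact: cvg_id.
exact: exprn_continuous.
Qed.

Lemma continuous_g : continuous (@g R).
Proof.
move=> s; apply: (@cvgB _ _ _ _ _ (fun _ : R => 1 : R) (fun y : R => y ^+ 2)).
  exact: cvg_cst.
exact: exprn_continuous.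
Qed.

Lemma integral_g_gt0 u : nontrivially_bounded u ->
  0 < \int[mu]_(x in Omega) g (u x).
Proof.
move=> [su u1 [x0 Ox0 ux0]].
apply: (Rintegral_open_gt0 hmu oO bO _ _ Ox0).
- exact: (state_comp continuous_g su).1.
- by move=> x /OcO /u1; exact: g_ge0.
- by move: ux0; rewrite ltr_norml /g => /andP[h1 h2]; nra.
Qed.

Lemma normr_lambda_le1 u : nontrivially_bounded u -> `|lambda mu Omega u| <= 1.
Proof.
move=> hu; have g0 := integral_g_gt0 hu; case: hu => su u1 _.
have mO := open_measurable_borel oO.
have jf := state_integrable hmu oO bO (state_comp continuous_f su).1.
have jg := state_integrable hmu oO bO (state_comp continuous_g su).1.
rewrite /lambda normrM normfV (gtr0_norm g0) ler_pdivrMr// mul1r.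
apply: (le_trans (le_normr_Rintegral _ jf)) => //.
apply: le_Rintegral => //; first exact: integrable_norm jf.
by move=> x /OcO /u1; exact: normr_f_le.
Qed.

Lemma nonlin_state u : state bc Omega u ->
  state bc Omega (nonlin mu Omega kappa u).
Proof.
apply: (@state_comp _ _ _ _
  (fun s => kappa * s + f s - lambda mu Omega u * g s)) => s.
apply: cvgB; last by apply: cvgMr; exact: continuous_g.
by apply: cvgD; [exact: cvgMr|exact: continuous_f].
Qed.

(** The point x0 of strict inequality is kept: the integrand of the variation of
    constants formula takes at s = tau the value N[u](x0), which is strictly
    between - kappa and kappa. *)
Lemma etd1_step_nontrivially_bounded u : nontrivially_bounded u ->
  nontrivially_bounded (etd1_step mu Omega S eps kappa tau u).
Proof.
move=> hu; have la1 := normr_lambda_le1 hu; case: (hu) => su u1 [x0 Ox0 ux0].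
have k0 : 0 < kappa by exact: lt_le_trans hkappa.
have sN := nonlin_state su.
have N_le x : closure Omega x -> `|nonlin mu Omega kappa u x| <= kappa.
  by move=> /u1; exact: nonlinearity_le.
have step_le x : closure Omega x ->
    `|expL S eps kappa tau u x| <= expR (- kappa * tau).
  move=> Ox; rewrite -[leRHS]mul1r.
  by apply: (expL_normr_le hS cO) => //; exact: ltW.
have curve_le x : closure Omega x -> forall s, 0 <= s <= tau ->
    `|expL S eps kappa (tau - s) (nonlin mu Omega kappa u) x| <=
    kappa * expR (- kappa * (tau - s)).
  move=> Ox s /andP[s0 st].
  by apply: (expL_normr_le hS cO) => //; [rewrite subr_ge0|exact: ltW].
split.
- have := state_linear 1 (expL_state hS eps kappa (ltW tau0) su)
    (Duhamel_state hS cO eps k0 tau0 sN).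
  by congr state; apply/funext => x; rewrite mul1r.
- move=> x Ox; apply: (le_trans (ler_normD _ _)).
  rewrite -[leRHS](subrKC (expR (- kappa * tau))) lerD ?step_le//.
  apply: Duhamel_le => //; [exact: (expL_continuous hS)|exact: curve_le].
- exists x0 => //; have Ox := OcO Ox0.
  apply: (le_lt_trans (ler_normD _ _)).
  rewrite -[ltRHS](subrKC (expR (- kappa * tau))) ler_ltD ?step_le//.
  apply: Duhamel_lt => //; [exact: (expL_continuous hS)|exact: curve_le|].
  rewrite /expL subrr !mulr0 expR0 mul1r (heat0 hS sN) ?inE//.
  exact: nonlinearity_lt.
Qed.

(** If |u| = 1 throughout Omega, the image of Omega is an interval contained in
    {-1, 1}, so u is constant and its integral is |Omega| up to sign. *)
Lemma initial_nontrivially_bounded u : connected Omega -> state bc Omega u ->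
  supnorm Omega u <= 1 ->
  `|\int[mu]_(x in Omega) u x| <> fine (mu Omega) -> nontrivially_bounded u.
Proof.
move=> kO su un hM.
have u1 x : closure Omega x -> `|u x| <= 1.
  by move=> Ox; exact: le_trans (normr_le_supnorm cO su.1 Ox) un.
split => //; apply: contrapT => no; apply: hM.
have mO := open_measurable_borel oO.
have norm_u1 x : Omega x -> `|u x| = 1.
  move=> Ox; apply/eqP; rewrite eq_le u1 ?leNgt//=; last exact: OcO.
  by apply/negP => h; apply: no; exists x.
have const c : (forall x, Omega x -> u x = c) -> `|c| = 1 ->
    `|\int[mu]_(x in Omega) u x| = fine (mu Omega).
  move=> uc c1; rewrite (@eq_Rintegral _ _ _ _ _ (fun=> c)).
    by rewrite Rintegral_cst// normrM c1 mul1r ger0_norm// fine_ge0.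
  by move=> x; rewrite inE => /uc.
have /connected_intervalP iu : connected (u @` Omega).
  apply: connected_continuous_connected => //.
  exact: continuous_subspaceW (@subset_closure _ _) su.1.
have [[x Ox ux]|nx] := pselect (exists2 x, Omega x & u x = -1); last first.
  apply: (const 1); last exact: normr1.
  move=> x Ox; have /eqP := norm_u1 _ Ox; rewrite eqr_norml => /andP[/orP[/eqP//|/eqP ux] _].
  by exfalso; apply: nx; exists x.
apply: (const (-1)); last by rewrite normrN normr1.
move=> y Oy; have /eqP := norm_u1 _ Oy; rewrite eqr_norml => /andP[/orP[/eqP uy|/eqP//] _].
have [z Oz uz] : (u @` Omega) 0.
  by apply: (iu (-1) 1); [exists x|exists y|rewrite lerN10 ler01].
by have := norm_u1 _ Oz; rewrite uz normr0 => /esym/eqP; rewrite oner_eq0.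
Qed.

End MaximumBound.

Theorem theorem1 (R : realType) (d : nat) (hd : d = 2%N \/ d = 3%N)
  (mu : {measure set (borel R d) -> \bar R}) (hmu : is_lebesgue mu)
  (Omega : set 'rV[R]_d) (hOmega : lipschitz_domain Omega)
  (bc : bcond R d) (hbc : bcond_ok bc Omega)
  (S : R -> ('rV[R]_d -> R) -> ('rV[R]_d -> R))
  (hS : heat_semigroup mu bc Omega S)
  (eps kappa : R) (heps : 0 < eps)
  (u0 : 'rV[R]_d -> R) (hu0 : state bc Omega u0)
  (hkappa : 4 <= kappa)
  (hu0norm : supnorm Omega u0 <= 1)
  (hM0 : `|\int[mu]_(x in Omega) u0 x| <> fine (mu Omega)) :
  is_maximum (stab_set R) 4
  /\
  forall tau : R, 0 < tau -> forall n : nat,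
    let u := etd1 mu Omega S eps kappa tau u0 in
    [/\ state bc Omega (u n),
        \int[mu]_(x in Omega) g (u n x) <> 0 &
        supnorm Omega (u n) <= 1].
Proof.
split; first exact: stab_set_maximum.
move=> tau tau0 n u.
case: hOmega => oO kO bO _.
have inv : nontrivially_bounded Omega bc (u n).
  rewrite /u /etd1; elim: n => [|n IHn] /=.
    exact: (initial_nontrivially_bounded oO bO kO hu0 hu0norm hM0).
  exact: (etd1_step_nontrivially_bounded eps hmu oO bO hS hkappa tau0).
have g0 := integral_g_gt0 hmu oO bO inv.
case: inv => su u1 _; split => //; first by move: g0 => /lt0r_neq0/eqP.
exact: supnorm_le.
Qed.
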